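(* Let $\mu$ be a standard (mean zero, variance one) probability measure on $\mathbb{R}$ with infinite support and all of whose moments are finite. Then the multiplicative renormalization method applies for $\mu$ with $h(x) = (1-x)^{-1}$ if and only if $\mu$ is a free Meixner distribution, i.e. if and only if there exist $a\in\mathbb{R}$ and $b\ge -1$ such that the Jacobi-Szegő parameters of $\mu$ satisfy $\alpha_0=0$, $\omega_1=1$, $\alpha_n=a$ for all $n\ge 1$ and $\omega_n=1+b$ for all $n\ge 2$.
   Context: Jacobi-Szegő parameters: for a probability measure $\mu$ on $\mathbb{R}$ with infinite support and finite moments of all orders, the monic polynomials $(P_n)_{n\ge 0}$ orthogonal with respect to $\mu$ satisfy $xP_n(x)=P_{n+1}(x)+\alpha_nP_n(x)+\omega_nP_{n-1}(x)$ with $P_{-1}=0$, $\alpha_n\in\mathbb{R}$, $\omega_0=1$, $\omega_n>0$ for $n\ge1$. The measure is standard (mean $0$, variance $1$) iff $\alpha_0=0$ and $\omega_1=1$. Pre-generating function: a pre-generating function for $\mu$ is a series $\phi(z,x)=\sum_{n\ge0}S_n(x)z^n$ where $S_n$ is a polynomial of degree $n$ for each $n\geq 0$ and $\limsup_{n\to\infty}\|S_n\|_{L^2(\mu)}<\infty$. Its multiplicative renormalization is $\psi(z,x)=\phi(z,x)/\mathbb{E}(\phi(z,X))=\sum_{n\ge0}Q_n(x)z^n$, where $X$ is a random variable with law $\mu$ (the expansion is in powers of $z$ around $z=0$). One says $\psi$ is a generating function for $\mu$ when the polynomials $(Q_n)_{n\ge0}$ are orthogonal with respect to $\mu$. The multiplicative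 renormalization method applies for $\mu$ with $h(x)=(1-x)^{-1}$ if there exists a function $\rho$, analytic around $0$ with $\rho(0)=0$ and $\rho'(0)\ne0$, such that $\phi(z,x)=h(\rho(z)x)=(1-\rho(z)x)^{-1}$ (expanded in powers of $z$ around $z=0$) is a pre-generating function for $\mu$ and its multiplicative renormalization $$\psi(z,x)=\frac{(1-\rho(z)x)^{-1}}{\mathbb{E}[(1-\rho(z)X)^{-1}]}$$ is a generating function for $\mu$. *)

(* Defs.v *)
From HB Require Import structures.
From mathcomp Require Import all_boot all_order all_algebra.
From mathcomp Require Import all_classical all_reals all_analysis.

Set Implicit Arguments.
Unset Strict Implicit.
Unset Printing Implicit Defensive.

Import Order.TTheory GRing.Theory Num.Theory.
Import numFieldNormedType.Exports.

Local Open Scope classical_set_scope.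
Local Open Scope ring_scope.

Definition msupport (R : realType) (mu : probability (measurableTypeR R) R) :
    set R :=
  [set x | forall U : set R, open U -> U x -> (0 < mu U)%E].

Definition finite_moments (R : realType)
    (mu : probability (measurableTypeR R) R) : Prop :=
  forall n : nat, mu.-integrable setT (fun x : R => (x ^+ n)%:E).

Definition standard (R : realType)
    (mu : probability (measurableTypeR R) R) : Prop :=
  ('E_mu[fun x : R => x] = 0)%E /\ (variance mu (fun x : R => x) = 1)%E.

Definition orthogonal_polys (R : realType)
    (mu : probability (measurableTypeR R) R) (Q : nat -> {poly R}) : Prop :=
  forall m n : nat, m != n -> \int[mu]_x ((Q m).[x] * (Q n).[x]) = 0.

Definition jacobi_szego (R : realType)
    (mu : probability (measurableTypeR R) R) (alpha omega : nat -> R) : Prop :=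
  exists P : nat -> {poly R},
    [/\ forall n, P n \is monic /\ size (P n) = n.+1,
        orthogonal_polys mu P,
        omega 0%N = 1,
        forall n, (1 <= n)%N -> 0 < omega n &
        forall n, 'X * P n =
          P n.+1 + alpha n *: P n
          + omega n *: (if n is m.+1 then P m else 0)].

Definition free_meixner (R : realType)
    (mu : probability (measurableTypeR R) R) : Prop :=
  exists a b : R, -1 <= b /\
    exists alpha omega : nat -> R,
      [/\ jacobi_szego mu alpha omega,
          alpha 0%N = 0,
          omega 1%N = 1,
          forall n, (1 <= n)%N -> alpha n = a &
          forall n, (2 <= n)%N -> omega n = 1 + b].

Definition expands_at0 (R : realType) (f : R -> R) (c : nat -> R) : Prop :=
  \forall z \near (0 : R), pseries c z @ \oo --> f z.

Definition analytic_at0 (R : realType) (f : R -> R) : Prop :=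
  exists c : nat -> R, expands_at0 f c.

(* The neighbourhood of z = 0 on which the expansion holds may depend on x;
   it cannot be uniform in x for f z x = (1 - rho z * x)^-1. *)
Definition poly_expansion (R : realType) (f : R -> R -> R)
    (S : nat -> {poly R}) : Prop :=
  forall x : R, expands_at0 (fun z => f z x) (fun n => (S n).[x]).

Definition pre_generating (R : realType)
    (mu : probability (measurableTypeR R) R) (phi : R -> R -> R) : Prop :=
  exists S : nat -> {poly R},
    [/\ poly_expansion phi S,
        forall n, size (S n) = n.+1 &
        (limn_esup (fun n => Lnorm mu 2%:E (fun x : R => (S n).[x]%:E))
          < +oo)%E].

(* Totality conventions (1 / 0 = 0, fine of an infinite value = 0) are
   harmless for phi z x = (1 - rho z * x)^-1: if it is pre-generating, then
   for z near 0 the series sum_n S_n(x) z^n converges absolutely for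
   mu-almost every x, hence rho z * x != 1 almost surely and phi z is
   mu-integrable, with expectation tending to that of S_0 = 1. *)
Definition mult_renorm (R : realType)
    (mu : probability (measurableTypeR R) R) (phi : R -> R -> R) :
    R -> R -> R :=
  fun z x => phi z x / fine 'E_mu[phi z].

Definition generating (R : realType)
    (mu : probability (measurableTypeR R) R) (psi : R -> R -> R) : Prop :=
  exists Q : nat -> {poly R}, poly_expansion psi Q /\ orthogonal_polys mu Q.

Definition mrm_applies (R : realType)
    (mu : probability (measurableTypeR R) R) (h : R -> R) : Prop :=
  exists rho : R -> R,
    [/\ analytic_at0 rho, rho 0 = 0, derive1 rho 0 != 0,
        pre_generating mu (fun z x => h (rho z * x)) &
        generating mu (mult_renorm mu (fun z x => h (rho z * x)))].

(* Main.v *)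
Require Import Defs.
From HB Require Import structures.
From mathcomp Require Import all_boot all_order all_algebra.
From mathcomp Require Import all_classical all_reals all_analysis.
From mathcomp Require Import measurable_realfun.
From mathcomp Require Import ring lra zify.
Import Order.TTheory GRing.Theory Num.Theory.
Import numFieldNormedType.Exports.
Local Open Scope ring_scope.

Set Implicit Arguments.
Unset Strict Implicit.
Unset Printing Implicit Defensive.

(** The theorem compares two descriptions of a power series in z whose
coefficients are polynomials in x.

If the method applies, let psi(z,x) = sum_n Q_n(x) z^n. Since
psi(z,x) = (1 - rho(z) x)^-1 / g(z), where g(z) is the expectation of
(1 - rho(z) X)^-1, putting x = 0 shows that 1/g(z) = sum_n Q_n(0) z^n.
Hence (1 - rho(z) x) psi(z,x) = psi(z,0), and comparing coefficients of z^n
gives the convolution recurrence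
  Q_n = Q_n(0) + x sum_(i >= 1) r_i Q_(n-i),   rho(z) = sum_i r_i z^i,
with Q_0 = 1 ([generating_convolution]). After rescaling by powers of r_1 the
Q_n become monic orthogonal polynomials P_n, and the inner products of the
recurrence with P_(n-1) and with P_(n-2) only see the coefficients of index at
most 3, which do not depend on n: this forces the Jacobi-Szego parameters to be
constant from alpha_1 and omega_2 on ([convolution_alpha],
[convolution_omega]).

Conversely, let P_n be the monic orthogonal polynomials of a free Meixner
distribution with parameters a and b. Their recurrence sums to the rational
generating function
  sum_n lam^n P_n(x) z^n
    = (1 + A z + B z^2) / (1 - (lam x - A) z + C z^2),
where A = a lam, B = b lam^2 and C = (1 + b) lam^2. The right-hand side is a
function of z times (1 - rho(z) x)^-1 for rho(z) = lam z / (1 + A z + C z^2).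
When lam is small, the L^2 norms of lam^n P_n are at most 1, so the series can
be integrated term by term ([integral_generating_series]); only the term n = 0
survives, which identifies the function of z as the inverse of the expectation.
The coefficients of (1 - rho(z) x)^-1 itself are handled through the
polynomials with generating function 1 / (1 - (lam x - A) z + C z^2), whose
L^2 norms stay bounded by induction ([cheb_second_moment_le]). *)

(** * Orthogonal polynomials of a positive functional *)

(** The term of index 0 of the convolution contributes X * P n, and all the
others have lower degree. *)
Lemma convolution_monic (R : nzRingType) (P : nat -> {poly R}) (s q : nat -> R) :
    P 0%N = 1 -> s 0%N = 1 ->
    (forall n, P n.+1 = (q n.+1)%:P + 'X * \sum_(i < n.+1) s i *: P (n - i)%N) ->
  forall n, P n \is monic /\ size (P n) = n.+1.
Proof.
move=> P0 s0 PE n; elim/ltn_ind: n => -[_|n IHn].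
  by rewrite P0 monic1 size_poly1.
have [Pn_monic Pn_size] := IHn n (ltnSn n).
pose r := \sum_(i < n) s i.+1 *: P (n - i.+1)%N.
have r_small : (size r < size (P n))%N.
  rewrite Pn_size ltnS (leq_trans (size_sum _ _ _)) //; apply/bigmax_leqP => i _.
  rewrite (leq_trans (size_scale_leq _ _)) //.
  have [_ ->] := IHn (n - i.+1)%N (leq_ltn_trans (leq_subr _ _) (ltnSn n)).
  by have := ltn_ord i; lia.
have -> : P n.+1 = (P n + r) * 'X + (q n.+1)%:P.
  by rewrite PE big_ord_recl subn0 s0 scale1r addrC commr_polyX.
have r_monic : P n + r \is monic by rewrite monicE lead_coefDl.
have r_neq0 := monic_neq0 r_monic.
rewrite monicE lead_coefDl ?lead_coefMX; last first.
  rewrite size_mulX // (leq_ltn_trans (size_polyC_leq1 _)) //.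
  by rewrite ltnS size_poly_gt0.
by rewrite size_MXaddC (negbTE r_neq0) size_polyDl // Pn_size -monicE.
Qed.

Section OrthogonalPolynomials.
Variables (R : realFieldType) (L : {scalar {poly R}}) (P : nat -> {poly R}).
Implicit Types p q : {poly R}.
Hypothesis L_gt0 : forall p : {poly R}, p != 0 -> 0 < L (p * p).
Hypothesis P_monic : forall n, P n \is monic.
Hypothesis P_size : forall n, size (P n) = n.+1.
Hypothesis P_orth : forall m n : nat, m != n -> L (P m * P n) = 0.

Let h n := L (P n * P n).

Lemma sqnorm_gt0 n : 0 < h n.
Proof. by apply: L_gt0; rewrite -size_poly_eq0 P_size. Qed.

(** One step of the expansion of a polynomial along the monic basis [P], from
which the two orthogonality lemmas below follow by induction on the degree. *)
Lemma size_sub_top n p : (size p <= n.+1)%N -> (size (p - p`_n *: P n)%R <= n)%N.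
Proof.
move=> sp; apply/leq_sizeP => j; rewrite leq_eqVlt => /predU1P[<-|nj].
  have /monicP := P_monic n; rewrite lead_coefE P_size /= => Pn1.
  by rewrite coefB coefZ Pn1 mulr1 subrr.
rewrite coefB coefZ [p`_j]nth_default ?(leq_trans sp) //.
by rewrite [(P n)`_j]nth_default ?P_size // mulr0 subrr.
Qed.

Lemma orth_low_degree n p : (size p <= n)%N -> L (P n * p) = 0.
Proof.
suff H m : forall q : {poly R},
  (m <= n)%N -> (size q <= m)%N -> L (P n * q) = 0 by exact: H.
elim: m => [|m IHm] q.
  by rewrite leqn0 size_poly_eq0 => _ /eqP ->; rewrite mulr0 raddf0.
move=> mn sq; rewrite -(subrK (q`_m *: P m) q) mulrDr linearD /=.
rewrite IHm ?size_sub_top ?(ltnW mn) // add0r -scalerAr linearZ /=.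
by rewrite P_orth ?mulr0 // gtn_eqF.
Qed.

Lemma orth_to_all_eq0 n p :
  (size p <= n)%N -> (forall k, (k < n)%N -> L (P k * p) = 0) -> p = 0.
Proof.
elim: n p => [|n IHn] p.
  by rewrite leqn0 size_poly_eq0 => /eqP.
move=> sp Lp; apply: IHn; last by move=> k kn; apply: Lp; exact: ltnW.
suff pn0 : p`_n = 0 by have := size_sub_top sp; rewrite pn0 scale0r subr0.
have := Lp n (ltnSn n); rewrite -{1}(subrK (p`_n *: P n) p) mulrDr linearD /=.
rewrite orth_low_degree ?size_sub_top // add0r -scalerAr linearZ /=.
by move/eqP; rewrite mulf_eq0 (gt_eqF (sqnorm_gt0 n)) orbF => /eqP.
Qed.

Lemma size_add_leq p q n :
  (size p <= n)%N -> (size q <= n)%N -> (size (p + q)%R <= n)%N.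
Proof. by move=> sp sq; rewrite (leq_trans (size_polyD _ _)) // geq_max sp. Qed.

Lemma size_mulX_le p n : (size p <= n)%N -> (size ('X * p)%R <= n.+1)%N.
Proof.
by move=> sp; rewrite (leq_trans (size_polyMleq _ _)) // size_polyX add2n /= ltnS.
Qed.

Lemma orth_next n : L (P n.+1 * ('X * P n)) = h n.+1.
Proof.
rewrite -(subrK (P n.+1) ('X * P n)) mulrDr linearD /= orth_low_degree ?add0r //.
have -> : P n.+1 = ('X * P n)`_n.+1 *: P n.+1.
  have /monicP := P_monic n; rewrite lead_coefE P_size /= => Pn1.
  by rewrite coefXM /= Pn1 scale1r.
by rewrite size_sub_top // size_mulX_le // P_size.
Qed.

Definition jacobi_alpha n := L (P n * ('X * P n)) / h n.
Definition jacobi_omega n := if n is m.+1 then h n / h m else 1.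

(** The difference of the two sides has degree at most n + 1, so it is enough
that it is orthogonal to every P k. For k < n - 1 this holds because X * P k
has degree less than n: multiplication by X is symmetric for the functional. *)
Lemma three_term_recurrence n :
  'X * P n = P n.+1 + jacobi_alpha n *: P n
             + jacobi_omega n *: (if n is m.+1 then P m else 0).
Proof.
apply/eqP; rewrite -subr_eq0; apply/eqP/(@orth_to_all_eq0 n.+2) => [|k kn].
  rewrite size_add_leq ?size_polyN ?size_mulX_le ?P_size //.
  rewrite !size_add_leq ?P_size // (leq_trans (size_scale_leq _ _)) ?P_size //.
  by case: n => [|n]; rewrite ?size_poly0 ?P_size //; lia.
rewrite mulrBr linearB /=; apply/eqP; rewrite subr_eq0; apply/eqP.
rewrite 2!mulrDr -2!scalerAr 2!linearD 2!linearZ /=.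
have hn0 m : h m != 0 by rewrite gt_eqF ?sqnorm_gt0.
move: kn; rewrite ltnS leq_eqVlt => /predU1P[->|].
  rewrite orth_next [L (P n.+1 * P n)]P_orth ?mulr0 ?addr0 ?gtn_eqF //.
  case: n => [|n]; first by rewrite mulr0 raddf0 mulr0 addr0.
  by rewrite [L (_ * P n)]P_orth ?mulr0 ?addr0 // gtn_eqF // ltnW.
rewrite ltnS leq_eqVlt => /predU1P[->|kn].
  rewrite P_orth ?ltn_eqF // add0r /jacobi_alpha divfK //.
  case: n => [|n]; first by rewrite mulr0 raddf0 mulr0 addr0.
  by rewrite P_orth ?gtn_eqF // mulr0 addr0.
rewrite [L (_ * P n.+1)]P_orth; last by rewrite ltn_eqF // ltnW.
rewrite [L (_ * P n)]P_orth ?ltn_eqF // mulr0 !add0r.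
have -> : P k * ('X * P n) = P n * ('X * P k) by ring.
case: n kn => // n; rewrite ltnS leq_eqVlt => /predU1P[->|kn].
  by rewrite orth_next /= divfK.
rewrite orth_low_degree ?size_mulX_le ?P_size // P_orth ?mulr0 //.
by rewrite ltn_eqF.
Qed.

Lemma jacobi_omega_gt0 n : 0 < jacobi_omega n.
Proof. by case: n => [|n] //=; rewrite divr_gt0 ?sqnorm_gt0. Qed.

(** A convolution recurrence with coefficients [s] that do not depend on n is so
rigid that it determines the Jacobi-Szego parameters: against P k, all terms of
index i > n + 1 - k vanish by degree, and the remaining ones are the
parameters and norms themselves. *)
Section ConvolutionRecurrence.
Variables (s q : nat -> R).
Hypothesis s0 : s 0%N = 1.
Hypothesis PE :
  forall n, P n.+1 = (q n.+1)%:P + 'X * \sum_(i < n.+1) s i *: P (n - i).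

Lemma inner_convolution n k : (0 < k)%N ->
  L (P k * P n.+1) = \sum_(i < n.+1) s i * L (P k * ('X * P (n - i))).
Proof.
move=> k0; rewrite [P n.+1]PE mulrDr linearD /= orth_low_degree ?add0r; last first.
  by rewrite (leq_trans (size_polyC_leq1 _)).
rewrite mulr_sumr mulr_sumr linear_sum; apply: eq_bigr => i _ /=.
by rewrite -!scalerAr linearZ.
Qed.

(** Inner product of P (n + 2) with P (n + 1): only i = 0 and i = 1 remain. *)
Lemma convolution_alpha n : jacobi_alpha n.+1 = - s 1%N.
Proof.
have := @inner_convolution n.+1 n.+1 isT; rewrite P_orth ?ltn_eqF //.
rewrite !big_ord_recl /= s0 mul1r subSS !subn0 orth_next.
rewrite big1 ?addr0 => [/esym/eqP|i _].
  rewrite addr_eq0 => /eqP H; rewrite /jacobi_alpha H -/(h _).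
  by rewrite -mulNr mulfK // gt_eqF // sqnorm_gt0.
rewrite orth_low_degree ?mulr0 // size_mulX_le // P_size.
by rewrite subSS /bump /= !add1n; have := ltn_ord i; lia.
Qed.

(** Inner product of P (n + 3) with P (n + 1): only i = 0, 1, 2 remain. *)
Lemma convolution_omega n : jacobi_omega n.+2 = s 1%N ^+ 2 - s 2%N.
Proof.
have := @inner_convolution n.+2 n.+1 isT; rewrite P_orth ?ltn_eqF //.
rewrite !big_ord_recl /= s0 mul1r /bump /= !subSS !subn0 orth_next.
have -> : P n.+1 * ('X * P n.+2) = P n.+2 * ('X * P n.+1) by ring.
rewrite orth_next big1 ?addr0 => [H|i _]; last first.
  rewrite orth_low_degree ?mulr0 // size_mulX_le // P_size.
  by rewrite /bump /= !add1n; have := ltn_ord i; lia.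
have hn0 : h n.+1 != 0 by rewrite gt_eqF ?sqnorm_gt0.
have := convolution_alpha n; rewrite /jacobi_alpha => /(canRL (divfK hn0)) A.
rewrite A in H; rewrite /jacobi_omega; apply: (canLR (mulfK hn0)).
apply/eqP; rewrite -subr_eq0 H; apply/eqP; ring.
Qed.
End ConvolutionRecurrence.
End OrthogonalPolynomials.

(** * Expectation of polynomials *)

Section MomentFunctional.
Local Open Scope classical_set_scope.
Local Open Scope ring_scope.
Variables (R : realType) (mu : probability (measurableTypeR R) R).
Hypothesis mu_moments : finite_moments mu.
Implicit Types p q : {poly R}.

Lemma integrable_horner p : mu.-integrable setT (fun x : R => (p.[x])%:E).
Proof.
rewrite (_ : (fun _ => _) =
  fun x : R => (\sum_(i < size p) (p`_i * x ^+ i)%:E)%E); last first.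
  by apply/funext => x; rewrite horner_coef sumEFin.
apply: integrable_sum => // i _ /=; under eq_fun do rewrite EFinM.
by apply: integrableZl => //; exact: mu_moments.
Qed.

(** The moment condition is an argument of the functional so that linearity can
be attached to it as a structure. *)
Definition mean_poly of finite_moments mu := fun p => \int[mu]_x p.[x].

Let Lm := mean_poly mu_moments.

Lemma mean_polyE p : (\int[mu]_x (p.[x])%:E)%E = (Lm p)%:E.
Proof. by rewrite /Lm /mean_poly fineK // integrable_fin_num // integrable_horner. Qed.

Lemma mean_poly_scalar : scalar Lm.
Proof.
move=> c p q; apply: EFin_inj; rewrite EFinD EFinM -!mean_polyE.
under eq_integral do rewrite hornerD hornerZ EFinD EFinM.
rewrite integralD //; first by rewrite integralZl // integrable_horner.
- by apply: integrableZl => //; exact: integrable_horner.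
- exact: integrable_horner.
Qed.

(** If the square of p has zero expectation, then p vanishes almost everywhere;
as the set where p is nonzero is open, it misses the support, and the support
consists of roots of p. *)
Lemma mean_poly_sqr_gt0 p :
  infinite_set (msupport mu) -> p != 0 -> 0 < Lm (p * p).
Proof.
move=> supp_inf p0; rewrite lt_neqAle; apply/andP; split; last first.
  by apply: Rintegral_ge0 => x _; rewrite hornerM -expr2 sqr_ge0.
apply/negP => /eqP Lp0; apply: supp_inf.
have p0_ae : ae_eq mu setT (fun x => ((p * p).[x])%:E) (cst 0%E).
  apply/ae_eq_integral_abs => //; first exact: (measurable_int mu (integrable_horner _)).
  under eq_integral => x _.
    rewrite gee0_abs ?lee_fin ?hornerM -?expr2 ?sqr_ge0 // expr2 -hornerM; over.
  by rewrite mean_polyE -Lp0.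
have op : open [set x | p.[x] != 0].
  have -> : [set x | p.[x] != 0] = horner p @^-1` (~` [set 0]).
    by apply/seteqP; split => x /= /eqP.
  apply: open_comp; first by move=> x _; exact: continuous_horner.
  by rewrite openC; exact: closed_eq.
have mp := open_measurable op.
have pN0 : mu [set x | p.[x] != 0] = 0%E.
  case: p0_ae => N [mN N0 subN]; apply: (@subset_measure0 _ _ _ mu _ N) => //.
  move=> x /= px; apply: subN => /= /(_ I) [] /eqP.
  by rewrite hornerM mulf_eq0 orbb (negbTE px).
apply: contrapT => /infinite_set_fset -/(_ (size p))[B Bsub].
apply/negP; rewrite -ltnNge; apply: max_poly_roots => //; last exact: finmap.fset_uniq.
apply/allP => x /Bsub xsupp; apply/negPn/negP => px.
have /xsupp : [set y | p.[y] != 0] x by [].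
by move=> /(_ op); rewrite pN0 ltxx.
Qed.

HB.instance Definition _ :=
  GRing.isLinear.Build R {poly R} R *%R (mean_poly mu_moments) mean_poly_scalar.

Lemma mean_poly1 : Lm 1 = 1.
Proof.
apply: EFin_inj; rewrite -mean_polyE -(expectation_cst mu 1) unlock.
by apply: eq_integral => x _; rewrite hornerC.
Qed.

Lemma mean_poly_standard : standard mu -> Lm 'X = 0 /\ Lm ('X * 'X) = 1.
Proof.
case=> EX VX; have LX : Lm 'X = 0.
  apply: EFin_inj; rewrite -mean_polyE -[RHS]EX [in RHS]unlock.
  by apply: eq_integral => x _; rewrite hornerX.
split => //; apply: EFin_inj; rewrite -mean_polyE -[RHS]VX /variance.
rewrite [in RHS]unlock EX /= [in RHS]unlock; apply: eq_integral => x _.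
rewrite hornerM hornerX; congr EFin; rewrite -[RHS]/((x - 0) * (x - 0)) subr0 //.
Qed.

Lemma orthogonal_polysP (P : nat -> {poly R}) :
  orthogonal_polys mu P <-> forall m n : nat, m != n -> Lm (P m * P n) = 0.
Proof.
rewrite /orthogonal_polys /Lm /mean_poly.
by split=> oP m n mn; rewrite -[RHS](oP m n mn); apply: eq_Rintegral => x _;
  rewrite hornerM.
Qed.
End MomentFunctional.

(** * Coefficients of power series expansions at 0 *)

Section TaylorAtZero.
Local Open Scope classical_set_scope.
Local Open Scope ring_scope.
Variable R : realType.
Implicit Types (f g : R -> R) (c : nat -> R) (p q : {poly R}) (n : nat).

(** Expansions are compared through their truncations, up to an error of the
order of z^n. This keeps the multiplication of series inside the ring of
polynomials. *)
Definition bigO0 n f :=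
  exists C, \forall z \near (0 : R)^', `|f z| <= C * `|z| ^+ n.

Lemma bigO0_near n f g :
  (\forall z \near (0 : R)^', f z = g z) -> bigO0 n f -> bigO0 n g.
Proof. by move=> fg [C fC]; exists C; near=> z; rewrite -(near fg z) //; near: z.
Unshelve. all: by end_near. Qed.

Lemma bigO0D n f g : bigO0 n f -> bigO0 n g -> bigO0 n (f \+ g).
Proof.
move=> [C fC] [D gD]; exists (C + D); near=> z.
by rewrite mulrDl (le_trans (ler_normD _ _)) // lerD //; near: z.
Unshelve. all: by end_near. Qed.

Lemma bigO0N n f : bigO0 n f -> bigO0 n (fun z => - f z).
Proof. by move=> [C fC]; exists C; under eq_near do rewrite normrN. Qed.

Lemma bigO0M m n f g : bigO0 m f -> bigO0 n g -> bigO0 (m + n) (f \* g).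
Proof.
move=> [C fC] [D gD]; exists (C * D); near=> z.
rewrite normrM exprD mulrACA ler_pM //; near: z => //.
Unshelve. all: by end_near. Qed.

Lemma bigO0W m n f : (m <= n)%N -> bigO0 n f -> bigO0 m f.
Proof.
move=> mn [C fC]; exists `|C|; near=> z.
rewrite (le_trans (near fC z _)) // (le_trans (ler_wpM2r _ (ler_norm C))) //.
rewrite ler_wpM2l // -(subnK mn) exprD ler_piMl ?exprn_ge0 ?exprn_ile1 //.
by near: z; exact: dnbhs0_le.
Unshelve. all: by end_near. Qed.

Lemma bigO0_cst (a : R) : bigO0 0 (cst a).
Proof. by exists `|a|; near=> z; rewrite expr0 mulr1. Unshelve. all: by end_near. Qed.

Lemma bigO0_id : bigO0 1 id.
Proof. by exists 1; near=> z; rewrite expr1 mul1r. Unshelve. all: by end_near. Qed.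

Lemma bigO0_small f e : bigO0 1 f -> 0 < e -> \forall z \near (0 : R)^', `|f z| < e.
Proof.
move=> [C fC] e0; near=> z.
apply: (@le_lt_trans _ _ (C * `|z| ^+ 1)); first by near: z.
apply: (@le_lt_trans _ _ ((`|C| + 1) * `|z|)).
  by rewrite expr1 ler_wpM2r // (le_trans (ler_norm C)) // lerDl.
rewrite mulrC -ltr_pdivlMr ?ltr_wpDl //; near: z; apply: dnbhs0_lt.
by rewrite divr_gt0 // ltr_wpDl.
Unshelve. all: by end_near. Qed.

Lemma bigO0_horner p : bigO0 0 (horner p).
Proof.
elim/poly_ind: p => [|p a Op].
  by apply: bigO0_near (bigO0_cst 0); near=> z; rewrite horner0.
apply: (@bigO0_near _ ((horner p \* id) \+ cst a)).
  by near=> z; rewrite hornerMXaddC.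
apply: bigO0D (bigO0_cst a).
by apply: bigO0W (bigO0M Op bigO0_id).
Unshelve. all: by end_near. Qed.

(** Uniqueness of the coefficients: dividing by z turns the order n + 1 into the
order n, so the statement about p follows from the constant case. *)
Lemma bigO0_horner_coef_eq0 n p : bigO0 n (horner p) ->
  forall k, (k < n)%N -> p`_k = 0.
Proof.
elim: n p => // n IHn p; elim/poly_ind: p => [|p a _] Op.
  by move=> k _; rewrite coef0.
have a0 : a = 0.
  have : bigO0 1 (cst a).
    apply: (@bigO0_near _ ((horner (p * 'X + a%:P)) \- (horner p \* id))).
      by near=> z; rewrite /= hornerMXaddC; ring.
    apply: bigO0D; first exact: bigO0W Op.
    by apply: bigO0N; exact: bigO0M (bigO0_horner p) bigO0_id.
  move=> Oa; apply/eqP/negPn/negP => an0; near (0 : R)^' => z.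
  suff : `|a| < `|a| by rewrite ltxx.
  by near: z; apply: bigO0_small Oa _; rewrite normr_gt0.
rewrite a0 addr0 in Op *.
suff Oq : bigO0 n (horner p).
  by case=> [|k] kn; rewrite coefMX //=; exact: IHn.
case: Op => C pC; exists C; near=> z.
have z0 : 0 < `|z| by rewrite normr_gt0; near: z; exact: nbhs_dnbhs_neq.
rewrite -(ler_pM2r z0) -mulrA -exprSr -normrM -hornerMX; near: z; exact: pC.
Unshelve. all: by end_near. Qed.

Lemma horner_inj p q : (forall x : R, p.[x] = q.[x]) -> p = q.
Proof.
move=> pq; apply/eqP; rewrite -subr_eq0; apply/eqP/polyP => k; rewrite coef0.
apply: (@bigO0_horner_coef_eq0 k.+1) => //; exists 0; near=> z.
by rewrite hornerD hornerN pq subrr normr0 mul0r.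
Unshelve. all: by end_near. Qed.

(** The last term on the left makes the bound inductive in m. *)
Lemma geometric_tail_le (r : R) n m : 0 <= r -> r <= 2^-1 ->
  \sum_(n <= k < n + m) r ^+ k + 2 * r ^+ (n + m) <= 2 * r ^+ n.
Proof.
move=> r0 r1; elim: m => [|m IHm]; first by rewrite addn0 big_geq // add0r.
apply: le_trans IHm; rewrite addnS big_nat_recr ?leq_addr //= -addrA lerD2l exprS.
have : 0 <= r ^+ (n + m) by exact: exprn_ge0.
by move: (r ^+ _) => t t0; nra.
Qed.

(** Convergence at one point t > 0 bounds the terms c_k t^k, which makes the tail
of index n geometric for |z| <= t / 2. *)
Lemma expands_bigO0 f c n : expands_at0 f c ->
  bigO0 n (fun z => f z - (\poly_(k < n) c k).[z]).
Proof.
move=> /nbhs_ballP[e /= e0 fE].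
have [t t0 te] : exists2 t, 0 < t & t < e.
  by exists (e / 2); [rewrite divr_gt0|rewrite ltr_pdivrMr // ltr_pMr // ltr1n].
have ct : cvgn (pseries c t).
  by apply/cvg_ex; exists (f t); apply: fE; rewrite /ball /= sub0r normrN gtr0_norm.
have [M [_ cM]] := cvg_series_bounded ct.
have {cM} cM k : `|c k * t ^+ k| <= `|M| + 1.
  by apply: cM => //; rewrite (le_lt_trans (ler_norm M)) // ltrDl.
exists ((`|M| + 1) * 2 / t ^+ n); near=> z.
have zt : `|z| <= t / 2 by near: z; apply: dnbhs0_le; rewrite divr_gt0.
have ze : `|z| < e.
  by apply: le_lt_trans zt (lt_trans _ te); rewrite ltr_pdivrMr // ltr_pMr // ltr1n.
have zE : pseries c z @ \oo --> f z by apply: fE; rewrite /ball /= sub0r normrN.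
have : (fun N => `|pseries c z N - (\poly_(k < n) c k).[z]|) @ \oo -->
    `|f z - (\poly_(k < n) c k).[z]|.
  by apply: cvg_norm; apply: cvgB => //; exact: cvg_cst.
move/cvgr_to_le; apply; exists n => // N /= nN.
rewrite /pseries /series /= horner_poly -(big_mkord xpredT (fun i => c i * z ^+ i)).
rewrite (big_cat_nat (n := n)) //= addrAC subrr add0r.
apply: le_trans (ler_norm_sum _ _ _) _.
have r0 : 0 <= `|z| / t by rewrite divr_ge0 // ltW.
have r1 : `|z| / t <= 2^-1 by rewrite ler_pdivrMr // mulrC.
apply: (@le_trans _ _ (\sum_(n <= k < N) (`|M| + 1) * (`|z| / t) ^+ k)).
  apply: ler_sum => k _.
  rewrite (_ : c k * z ^+ k = c k * t ^+ k * (z / t) ^+ k); last first.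
    by rewrite expr_div_n mulrACA divff ?expf_neq0 ?gt_eqF // mulr1.
  by rewrite normrM normrX normf_div (gtr0_norm t0) ler_wpM2r // exprn_ge0.
rewrite -big_distrr /= -!mulrA ler_wpM2l ?addr_ge0 //.
rewrite [_^-1 * _]mulrC -expr_div_n.
rewrite -(subnKC nN) (le_trans _ (@geometric_tail_le _ n (N - n) r0 r1)) //.
by rewrite lerDl mulr_ge0 // exprn_ge0.
Unshelve. all: by end_near. Qed.

Lemma expands_at0_coef0 f c : expands_at0 f c -> f 0 = c 0%N.
Proof.
move=> /nbhs_singleton f0; apply: (cvg_unique _ f0) => //.
apply: cvg_near_cst; exists 1%N => // n /= n0.
rewrite /pseries /series /= big_ltn // big_nat big1 ?addr0 ?expr0 ?mulr1 //.
by move=> i /andP[i0 _]; rewrite expr0n gtn_eqF // mulr0.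
Qed.

Lemma expands_at0_derive1 f c : expands_at0 f c -> derive1 f 0 = c 1%N.
Proof.
move=> fc; have f0 := expands_at0_coef0 fc.
have [C fC] := @expands_bigO0 _ _ 2 fc.
apply: cvg_lim => //; apply/cvgrPdist_le => e e0; near=> h.
have h0 : h != 0 by near: h; exact: nbhs_dnbhs_neq.
have hC : `|f h - c 0%N - c 1%N * h| <= C * `|h| ^+ 2.
  rewrite (_ : _ - _ = f h - (\poly_(k < 2) c k).[h]); first by near: h.
  by rewrite horner_poly !big_ord_recl big_ord0 /= expr0 expr1; ring.
rewrite addr0 f0 distrC -(ler_pM2r (_ : 0 < `|h|)) ?normr_gt0 // -normrM.
rewrite mulrBl /GRing.scale /= mulrAC mulVf // mul1r (le_trans hC) //.
rewrite expr2 mulrA ler_wpM2r //.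
rewrite (le_trans (ler_wpM2r _ (ler_norm C))) //.
apply: (@le_trans _ _ ((`|C| + 1) * `|h|)); first by rewrite ler_wpM2r // lerDl.
rewrite mulrC -ler_pdivlMr ?ltr_wpDl //; near: h; apply: dnbhs0_le.
by rewrite divr_gt0 // ltr_wpDl.
Unshelve. all: by end_near. Qed.

(** Replacing each function by its truncation of order n changes
(1 - rho x) F - H = 0 by an error of the order of z^(n+1); what remains is a
polynomial in z, so its coefficient of index n vanishes. *)
Lemma expands_at0_quotient_coef (rho F H : R -> R) (r c h : nat -> R) (x : R) :
    expands_at0 rho r -> expands_at0 F c -> expands_at0 H h ->
    (\forall z \near (0 : R)^', (1 - rho z * x) * F z = H z) ->
  forall n, c n = h n + x * \sum_(i < n.+1) r i * c (n - i)%N.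
Proof.
move=> Er Ec Eh FH n.
pose T (a : nat -> R) := \poly_(k < n.+1) a k.
have Tn a k : (k < n.+1)%N -> (T a)`_k = a k by move=> kn; rewrite coef_poly kn.
have Or := @expands_bigO0 _ _ n.+1 Er; have Oc := @expands_bigO0 _ _ n.+1 Ec.
have Oh := @expands_bigO0 _ _ n.+1 Eh.
suff : bigO0 n.+1 (horner ((1 - x *: T r) * T c - T h)).
  move=> /bigO0_horner_coef_eq0 /(_ n (ltnSn n)).
  rewrite mulrBl mul1r -scalerAl !coefB coefZ coefM !Tn //.
  have -> : \sum_(j < n.+1) (T r)`_j * (T c)`_(n - j) =
      \sum_(i < n.+1) r i * c (n - i)%N.
    by apply: eq_bigr => i _; rewrite !Tn // ltnS leq_subr.
  by move=> /eqP; rewrite subr_eq0 subr_eq => /eqP.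
have Oc0 : bigO0 0 F.
  apply: (@bigO0_near _ ((fun z => F z - (T c).[z]) \+ horner (T c))).
    by near=> z; rewrite /= subrK.
  by apply: bigO0D (bigO0_horner _); exact: bigO0W Oc.
have O1 : bigO0 n.+1 (cst x \* ((fun z => rho z - (T r).[z]) \* F)).
  by rewrite -[n.+1]add0n -[n.+1]addn0; exact: bigO0M (bigO0_cst x) (bigO0M Or Oc0).
have O2 : bigO0 n.+1 (horner (1 - x *: T r) \* (fun z => F z - (T c).[z])).
  by rewrite -[n.+1]add0n; exact: bigO0M (bigO0_horner _) Oc.
apply: bigO0_near (bigO0D (bigO0D O1 (bigO0N O2)) Oh); near=> z => /=.
have <- : (1 - rho z * x) * F z = H z by near: z.
rewrite !hornerE /=; ring.
Unshelve. all: by end_near. Qed.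
End TaylorAtZero.

(** * A renormalizable measure is free Meixner *)

Section RenormalizationImpliesMeixner.
Local Open Scope classical_set_scope.
Local Open Scope ring_scope.
Variables (R : realType) (mu : probability (measurableTypeR R) R).

(** At x = 0 the renormalized series is the inverse of the expectation, so the
latter can be eliminated: (1 - rho(z) x) psi(z,x) = psi(z,0). *)
Lemma generating_convolution (rho : R -> R) (r : nat -> R) (Q : nat -> {poly R}) :
    expands_at0 rho r -> rho 0 = 0 ->
    poly_expansion (mult_renorm mu (fun z x => (1 - rho z * x)^-1)) Q ->
  Q 0%N = 1 /\ forall n, Q n.+1 =
    ((Q n.+1).[0])%:P + 'X * \sum_(i < n.+1) r i.+1 *: Q (n - i)%N.
Proof.
move=> rhoE rho0 QE.
have r0 : r 0%N = 0 by rewrite -(expands_at0_coef0 rhoE).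
have QX n : Q n = ((Q n).[0])%:P + 'X * \sum_(i < n.+1) r i *: Q (n - i)%N.
  apply: horner_inj => x; rewrite hornerD hornerM hornerC hornerX horner_sum.
  under eq_bigr do rewrite hornerZ.
  apply: (expands_at0_quotient_coef rhoE (QE x) (QE 0)); near=> z.
  have rx : 1 - rho z * x != 0.
    have : `|rho z * x| < 1.
      near: z; apply: bigO0_small => //.
      apply: bigO0_near (bigO0M (expands_bigO0 1 rhoE) (bigO0_cst x)).
      by near=> z; rewrite /= horner_poly big_ord1 expr0 mulr1 r0 subr0.
    by apply: contraTneq => /eqP; rewrite subr_eq0 => /eqP <-; rewrite normr1 ltxx.
  by rewrite /mult_renorm mulr0 subr0 invr1 mulrA divff.
split=> [|n]; last first.
  by rewrite {1}QX big_ord_recl r0 scale0r add0r.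
rewrite QX big_ord1 r0 scale0r mulr0 addr0.
rewrite -(expands_at0_coef0 (QE 0)) /mult_renorm rho0.
rewrite (_ : (fun _ => _) = cst 1) ?expectation_cst /= ?mulr0 ?subr0 ?invr1 ?mulr1 //.
by apply/funext => x; rewrite mul0r subr0 invr1.
Unshelve. all: by end_near. Qed.

(** With s_i = r_(i+1) / r_1^(i+1), the parameters are a = - s_1 and
1 + b = s_1^2 - s_2; the bound on b comes from omega_2 > 0. *)
Lemma mrm_applies_free_meixner :
    finite_moments mu -> infinite_set (msupport mu) -> standard mu ->
  mrm_applies mu (fun x => (1 - x)^-1) -> free_meixner mu.
Proof.
move=> mu_moments mu_supp mu_std [rho [[r rhoE] rho0 drho _ [Q [QE Q_orth]]]].
have [Q0 QS] := generating_convolution rhoE rho0 QE.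
rewrite (expands_at0_derive1 rhoE) in drho.
pose L : {scalar {poly R}} := mean_poly mu_moments.
have L_gt0 (p : {poly R}) : p != 0 -> 0 < L (p * p) by exact: mean_poly_sqr_gt0.
have L1 : L 1 = 1 := mean_poly1 mu_moments.
have [LX LXX] : L 'X = 0 /\ L ('X * 'X) = 1 := mean_poly_standard mu_moments mu_std.
pose t := (r 1%N)^-1.
pose P n := t ^+ n *: Q n; pose s i := t ^+ i.+1 * r i.+1.
pose q n := t ^+ n * (Q n).[0].
have P0 : P 0%N = 1 by rewrite /P expr0 scale1r.
have s0 : s 0%N = 1 by rewrite /s expr1 mulVf.
have PS n : P n.+1 = (q n.+1)%:P + 'X * \sum_(i < n.+1) s i *: P (n - i)%N.
  rewrite /q /P [in LHS]QS scalerDr polyCM -mul_polyC; congr (_ + _).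
  rewrite scalerAr scaler_sumr; congr (_ * _).
  apply: eq_bigr => i _; rewrite !scalerA; congr (_ *: _).
  rewrite /s mulrAC -exprD; congr (_ ^+ _ * _).
  by rewrite addSn subnKC // -ltnS ltn_ord.
have P_monic n := (convolution_monic P0 s0 PS n).1.
have P_size n := (convolution_monic P0 s0 PS n).2.
have P_orth m n : m != n -> L (P m * P n) = 0.
  move=> mn; rewrite /P -scalerAl -scalerAr !linearZ /=.
  have /(orthogonal_polysP mu_moments)/(_ m n mn) LQ := Q_orth.
  by rewrite LQ !mulr0.
exists (- s 1%N), (s 1%N ^+ 2 - s 2%N - 1).
have omegaE := convolution_omega L_gt0 P_monic P_size P_orth s0 PS.
split.
  rewrite lerBrDr addNr -(omegaE 0%N) ltW //.
  exact: jacobi_omega_gt0.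
exists (jacobi_alpha L P), (jacobi_omega L P); split.
- exists P; split=> //.
  + by apply/orthogonal_polysP; exact: P_orth.
  + by move=> n _; exact: jacobi_omega_gt0.
  + by move=> n; exact: three_term_recurrence.
- by rewrite /jacobi_alpha P0 mul1r mulr1 LX mul0r.
- have P1 : P 1%N = 'X.
    rewrite PS big_ord1 s0 scale1r P0 mulr1.
    suff -> : q 1%N = 0 by rewrite add0r.
    have := P_orth 1%N 0%N isT; rewrite PS big_ord1 s0 scale1r P0 !mulr1.
    by rewrite linearD /= LX addr0 -[(q 1%N)%:P]alg_polyC linearZ /= L1 mulr1.
  by rewrite /jacobi_omega P1 P0 mulr1 LXX L1 divr1.
- by case=> // n _; exact: (convolution_alpha L_gt0 P_monic P_size P_orth s0 PS).
- by case=> [|[|n]] // _; rewrite omegaE [RHS]addrC subrK.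
Qed.
End RenormalizationImpliesMeixner.

(** * Series with a quadratic denominator *)

(** The recurrence starts at index 3, so that the numerator has degree 2. *)
Section QuadraticRecurrence.
Local Open Scope classical_set_scope.
Local Open Scope ring_scope.
Variables (R : realType) (c : nat -> R) (u v : R).
Hypothesis cS : forall n, c n.+3 = u * c n.+2 - v * c n.+1.

Lemma pseries_quadratic_recurrence z n :
  pseries c z n.+3 - u * z * pseries c z n.+2 + v * z ^+ 2 * pseries c z n.+1 =
  c 0%N + (c 1%N - u * c 0%N) * z + (c 2%N - u * c 1%N + v * c 0%N) * z ^+ 2.
Proof.
rewrite /pseries /series /=; elim: n => [|n IHn].
  by rewrite !big_nat_recr //= !big_geq //=; ring.
rewrite -IHn (big_nat_recr n.+3) // (big_nat_recr n.+2) // (big_nat_recr n.+1) //=.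
by rewrite cS !exprS; ring.
Qed.

(** Stated at a single point of convergence rather than in a disc, because it is
also applied for a fixed z at almost every x, where the radius of convergence
in z is not controlled. *)
Lemma pseries_quadratic_lim z l : pseries c z @ \oo --> l ->
  (1 - u * z + v * z ^+ 2) * l =
  c 0%N + (c 1%N - u * c 0%N) * z + (c 2%N - u * c 1%N + v * c 0%N) * z ^+ 2.
Proof.
move=> cl; set N := RHS.
have cl_shift k : pseries c z (n + k)%N @[n --> \oo] --> l by rewrite cvg_shiftn.
have : pseries c z (n + 3)%N - u * z * pseries c z (n + 2)%N
    + v * z ^+ 2 * pseries c z (n + 1)%N @[n --> \oo] --> l - u * z * l + v * z ^+ 2 * l.
  by apply: cvgD; [apply: cvgB => //|]; apply: cvgM => //; exact: cvg_cst.
under eq_fun do rewrite addn3 addn2 addn1 pseries_quadratic_recurrence.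
move=> /(cvg_unique _ (cvg_cst N)) -> //; ring.
Qed.

Lemma quadratic_recurrence_bound n :
  `|c n| <= (`|c 0%N| + `|c 1%N| + `|c 2%N|) * (1 + `|u| + `|v|) ^+ n.
Proof.
set C := _ + _ + _; set K := 1 + _ + _.
have K1 : 1 <= K by rewrite /K -addrA lerDl addr_ge0.
have C0 : 0 <= C by rewrite !addr_ge0.
have CK k m : `|c k| <= C -> `|c k| <= C * K ^+ m.
  by move=> ckC; rewrite (le_trans ckC) // ler_peMr // exprn_ege1.
have [c0 c1 c2] : [/\ `|c 0%N| <= C, `|c 1%N| <= C & `|c 2%N| <= C].
  by rewrite /C; split; have := normr_ge0 (c 0%N); have := normr_ge0 (c 1%N);
    have := normr_ge0 (c 2%N); lra.
elim/ltn_ind: n => -[|[|[|n]]] IHn; [exact: CK..|].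
rewrite cS (le_trans (ler_normB _ _)) // !normrM.
have /(ler_wpM2l (normr_ge0 u)) b2 := IHn n.+2 (ltnSn _).
have /(ler_wpM2l (normr_ge0 v)) b1 := IHn n.+1 (leqW (ltnSn _)).
rewrite (le_trans (lerD b2 b1)) // !exprS.
have : 0 <= C * (K * K ^+ n) by rewrite !mulr_ge0 ?exprn_ge0 ?(le_trans _ K1).
move: (K ^+ n) => t; have u0 := normr_ge0 u; have v0 := normr_ge0 v.
move=> t0; rewrite (_ : C * (K * (K * (K * t))) = K * K * (C * (K * t))); last by ring.
rewrite (_ : _ + _ = (`|u| * K + `|v|) * (C * (K * t))); last by ring.
by apply: ler_wpM2r => //; rewrite /K in K1 *; nra.
Qed.

Lemma quadratic_expands_at0 (f : R -> R) :
    (\forall z \near (0 : R), f z = (c 0%N + (c 1%N - u * c 0%N) * z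
       + (c 2%N - u * c 1%N + v * c 0%N) * z ^+ 2) / (1 - u * z + v * z ^+ 2)) ->
  expands_at0 f c.
Proof.
move=> fE; rewrite /expands_at0.
set K := 1 + `|u| + `|v|; have K1 : 1 <= K by rewrite /K -addrA lerDl addr_ge0.
have K0 : 0 < K by rewrite (lt_le_trans _ K1).
near=> z.
have zK : `|z| <= (2 * K)^-1.
  near: z; exists (2 * K)^-1 => [|y /=]; first by rewrite /= invr_gt0 mulr_gt0.
  by rewrite sub0r normrN => /ltW.
have Kz : K * `|z| <= 2^-1.
  by rewrite (le_trans (ler_wpM2l (ltW K0) zK)) // invfM mulrCA divff ?mulr1 // gt_eqF.
have cz : cvgn (pseries c z).
  apply: normed_cvg; rewrite /normed_series_of /=.
  set C := `|c 0%N| + `|c 1%N| + `|c 2%N|.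
  apply: (@series_le_cvg _ _ (geometric C 2^-1)) => [n|n|n|] /=.
  - exact: normr_ge0.
  - by rewrite mulr_ge0 ?exprn_ge0 // /C !addr_ge0.
  - rewrite normrM (le_trans (ler_wpM2r (normr_ge0 _) (quadratic_recurrence_bound n))) //.
    rewrite -/C -/K -mulrA normrX -exprMn ler_wpM2l ?addr_ge0 //.
    by apply: lerXn2r => //; rewrite nnegrE ?invr_ge0 // mulr_ge0 // ltW.
  - by apply: is_cvg_geometric_series; rewrite normrV ?unitfE // ger0_norm // invf_lt1 // ltr1n.
have D0 : 1 - u * z + v * z ^+ 2 != 0.
  have z0 := normr_ge0 z; have u0 := normr_ge0 u; have v0 := normr_ge0 v.
  have uz : u * z <= `|u| * `|z| by rewrite -normrM ler_norm.
  have vz : - (v * z ^+ 2) <= `|v| * `|z| ^+ 2.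
    by rewrite -normrX -normrM -normrN ler_norm.
  by apply: lt0r_neq0; rewrite /K in Kz; nra.
rewrite (near fE z) // -(pseries_quadratic_lim cz) [X in X / _]mulrC mulfK //.
Unshelve. all: by end_near. Qed.
End QuadraticRecurrence.

(** * Chebyshev-type polynomials and their second moments *)

Section ChebyshevPolynomials.
Local Open Scope ring_scope.
Variables (R : realFieldType) (lam A B : R).
Hypothesis lam_neq0 : lam != 0.

Let C := B + lam ^+ 2.
Let u : {poly R} := lam *: 'X - A%:P.

(** Rescaled and shifted Chebyshev polynomials of the second kind: the
coefficients in z of 1 / (1 - u z + C z^2). *)
Fixpoint cheb n : {poly R} :=
  match n with
  | 0 => 1
  | 1 => u
  | (m.+1 as k).+1 => u * cheb k - C *: cheb m
  end.

Lemma chebSS n : cheb n.+2 = u * cheb n.+1 - C *: cheb n.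
Proof. by []. Qed.

Lemma size_cheb n : size (cheb n) = n.+1.
Proof.
have su : size u = 2.
  rewrite /u -polyCN -mul_polyC size_MXaddC polyC_eq0 (negbTE lam_neq0) /=.
  by rewrite size_polyC lam_neq0.
elim/ltn_ind: n => -[|[|n]] IHn; rewrite ?size_poly1 //.
have sn1 := IHn n.+1 (ltnSn _); have sn := IHn n (leqW (ltnSn _)).
have s2 : size (u * cheb n.+1) = n.+3.
  by rewrite size_mul -?size_poly_eq0 ?su ?sn1.
rewrite chebSS size_polyDl s2 // size_polyN ltnS.
by rewrite (leq_trans (size_scale_leq _ _)) // sn.
Qed.

(** The coefficients in z of (1 - rho(z) X)^-1, because for
rho(z) = lam z / (1 + A z + C z^2) this function is equal to
1 + lam X z / (1 - u z + C z^2). *)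
Definition renorm_coef n : {poly R} :=
  if n is m.+1 then lam *: ('X * cheb m) else 1.

Lemma size_renorm_coef n : size (renorm_coef n) = n.+1.
Proof.
case: n => [|n]; first by rewrite size_poly1.
by rewrite /= size_scale // mulrC size_mulX -?size_poly_eq0 size_cheb.
Qed.

Lemma renorm_coefSSS n :
  renorm_coef n.+3 = u * renorm_coef n.+2 - C *: renorm_coef n.+1.
Proof. by rewrite /renorm_coef chebSS -!mul_polyC; ring. Qed.

Variable Q : nat -> {poly R}.
Hypothesis Q0 : Q 0%N = 1.
Hypothesis Q1 : Q 1%N = lam *: 'X.
Hypothesis Q2 : Q 2%N = u * Q 1%N + B%:P - C%:P.
Hypothesis QS : forall n, Q n.+3 = u * Q n.+2 - C *: Q n.+1.

(** Multiplication of the generating series of [cheb] by 1 + A z + B z^2. *)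
Lemma meixner_cheb n : Q n.+2 = cheb n.+2 + A *: cheb n.+1 + B *: cheb n.
Proof.
have uE : lam *: 'X = u + A%:P by rewrite subrK.
have Q1E : Q 1%N = u + A%:P by rewrite Q1 uE.
have Q2E : Q 2%N = cheb 2 + A *: cheb 1 + B *: cheb 0.
  by rewrite Q2 Q1E /= -!mul_polyC; ring.
have Q3E : Q 3%N = cheb 3 + A *: cheb 2 + B *: cheb 1.
  by rewrite QS Q2E Q1E /= -!mul_polyC; ring.
elim/ltn_ind: n => -[|[|n]] IHn //.
rewrite QS (IHn n.+1) // (IHn n) //.
by rewrite !chebSS -!mul_polyC; ring.
Qed.

(** The numerators 1 + A z + C z^2 and 1 + A z + B z^2 of the two series differ
by lam^2 z^2. *)
Lemma renorm_coef_meixner n :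
  renorm_coef n.+3 = Q n.+3 + lam ^+ 2 *: cheb n.+1.
Proof.
have uE : lam *: 'X = u + A%:P by rewrite subrK.
rewrite meixner_cheb /renorm_coef scalerAl uE [cheb n.+3]chebSS -!mul_polyC.
by rewrite /C polyCD; ring.
Qed.
End ChebyshevPolynomials.

Section SecondMoments.
Local Open Scope ring_scope.
Variables (R : realFieldType) (L : {scalar {poly R}}).
Hypothesis L_ge0 : forall p : {poly R}, 0 <= L (p * p).
Implicit Types p q : {poly R}.

Lemma second_moment_addr_le p q :
  L ((p + q) * (p + q)) <= 2 * (L (p * p) + L (q * q)).
Proof.
have := L_ge0 (p - q).
rewrite (_ : (p - q) * (p - q) = p * p + q * q - (2%:R : R) *: (p * q)); last first.
  by rewrite -mul_polyC polyC_natr; ring.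
rewrite (_ : (p + q) * (p + q) = p * p + q * q + (2%:R : R) *: (p * q)); last first.
  by rewrite -mul_polyC polyC_natr; ring.
by rewrite linearB !linearD /=; move: (L _) (L _) (L _) => ? ? ?; lra.
Qed.

Lemma second_moment_scale a p : L ((a *: p) * (a *: p)) = a ^+ 2 * L (p * p).
Proof. by rewrite -scalerAl -scalerAr scalerA linearZ. Qed.

Variables (lam A B : R) (Q : nat -> {poly R}).
Hypothesis lam_le : `|lam| <= 4^-1.
Hypothesis A_le : `|A| <= 4^-1.
Hypothesis B_le : `|B| <= 4^-1.
Hypothesis L1 : L 1 = 1.
Hypothesis LXX : L ('X * 'X) = 1.
Hypothesis Q_le1 : forall n, L (Q n * Q n) <= 1.
Hypothesis QT : forall n,
  Q n.+2 = cheb lam A B n.+2 + A *: cheb lam A B n.+1 + B *: cheb lam A B n.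

Let sqr_le (x : R) : `|x| <= 4^-1 -> x ^+ 2 <= 16^-1.
Proof.
move=> x4; rewrite -real_normK ?num_real // (_ : 16^-1 = (4^-1 : R) ^+ 2); last first.
  by rewrite exprVn -natrX.
by apply: lerXn2r => //; rewrite nnegrE // invr_ge0.
Qed.

(** Solving [meixner_cheb] for cheb (n + 2) gives a recursion that contracts,
since A and B are small, with a forcing term of norm at most 1. *)
Lemma cheb_second_moment_le n : L (cheb lam A B n * cheb lam A B n) <= 4.
Proof.
have l2 := sqr_le lam_le; have A2 := sqr_le A_le; have B2 := sqr_le B_le.
elim/ltn_ind: n => -[|[|n]] IHn.
- by rewrite mulr1 L1; lra.
- rewrite /= -[A%:P]alg_polyC -scaleNr.
  apply: le_trans (second_moment_addr_le _ _) _.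
  by rewrite !second_moment_scale LXX !mulr1 L1 sqrrN; lra.
have -> : cheb lam A B n.+2 =
    Q n.+2 + ((- A) *: cheb lam A B n.+1 + (- B) *: cheb lam A B n).
  by rewrite QT -!mul_polyC !polyCN; ring.
apply: le_trans (second_moment_addr_le _ _) _.
have := second_moment_addr_le ((- A) *: cheb lam A B n.+1) ((- B) *: cheb lam A B n).
rewrite !second_moment_scale !sqrrN.
have := IHn n.+1 (ltnSn _); have := IHn n (leqW (ltnSn _)); have := Q_le1 n.+2.
have := L_ge0 (cheb lam A B n.+1); have := L_ge0 (cheb lam A B n).
have := sqr_ge0 A; have := sqr_ge0 B.
move: (A ^+ 2) (B ^+ 2) A2 B2 => A' B' A2 B2 B0 A0.
move: (L (cheb lam A B n * _)) => y; move: (L (cheb lam A B n.+1 * _)) => x.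
move: (L (Q n.+2 * _)) => w; move: (L (_ * _)) => t y0 x0 w1 y3 x3.
have : A' * x <= 16^-1 * 4 by apply: ler_pM.
have : B' * y <= 16^-1 * 4 by apply: ler_pM.
lra.
Qed.

Hypothesis ST : forall n,
  renorm_coef lam A B n.+3 = Q n.+3 + lam ^+ 2 *: cheb lam A B n.+1.

Lemma renorm_coef_second_moment_le n :
  L (renorm_coef lam A B n.+3 * renorm_coef lam A B n.+3) <= 4.
Proof.
rewrite ST; apply: le_trans (second_moment_addr_le _ _) _.
rewrite second_moment_scale.
have l2 := sqr_le lam_le; have := Q_le1 n.+3; have := cheb_second_moment_le n.+1.
have T0 := L_ge0 (cheb lam A B n.+1).
have : (lam ^+ 2) ^+ 2 <= 16^-1.
  rewrite expr2 -[leRHS]mulr1; apply: ler_pM => //; rewrite ?sqr_ge0 //.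
  by move: l2; lra.
move: (L (cheb lam A B n.+1 * _)) T0 => x x0 l4 x3 y1.
have : (lam ^+ 2) ^+ 2 * x <= 16^-1 * 4.
  by apply: ler_pM => //; rewrite exprn_ge0 // sqr_ge0.
by move: y1; lra.
Qed.
End SecondMoments.

Section OrthogonalNorms.
Local Open Scope ring_scope.
Variables (R : realFieldType) (L : {scalar {poly R}}) (P : nat -> {poly R}).
Variables alpha omega : nat -> R.
Hypothesis P_orth : forall m n : nat, m != n -> L (P m * P n) = 0.
Hypothesis P_rec : forall n, 'X * P n =
  P n.+1 + alpha n *: P n + omega n *: (if n is m.+1 then P m else 0).

Lemma second_moment_jacobi n : L (P n.+1 * P n.+1) = omega n.+1 * L (P n * P n).
Proof.
have H1 : L (P n.+1 * ('X * P n)) = L (P n.+1 * P n.+1).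
  rewrite P_rec !mulrDr -!scalerAr !linearD !linearZ /=.
  rewrite [L (_ * P n)]P_orth ?gtn_eqF // mulr0 addr0.
  case: n => [|n]; first by rewrite mulr0 linear0 mulr0 addr0.
  by rewrite [L (_ * P n)]P_orth ?mulr0 ?addr0 // gtn_eqF // ltnW.
rewrite -H1 mulrCA mulrA P_rec !mulrDl -!scalerAl !linearD !linearZ /=.
rewrite (P_orth (m := n.+2)) ?gtn_eqF //.
by rewrite (P_orth (m := n.+1)) ?gtn_eqF // add0r mulr0 add0r.
Qed.
End OrthogonalNorms.

(** * Integration of the generating series *)

Section MeasureSide.
Local Open Scope classical_set_scope.
Local Open Scope ring_scope.
Variables (R : realType) (mu : probability (measurableTypeR R) R).
Hypothesis mu_moments : finite_moments mu.
Local Notation L := (mean_poly mu_moments).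
Implicit Types p : {poly R}.

Lemma Lnorm2_horner p :
  Lnorm mu 2%:E (fun x => (p.[x])%:E) = ((L (p * p)) `^ 2^-1)%:E.
Proof.
rewrite unlock -poweR_EFin; congr poweR; rewrite -mean_polyE.
apply: eq_integral => x _; rewrite /= hornerM -expr2.
by rewrite powR_mulrn ?normr_ge0 // real_normK ?num_real.
Qed.

Lemma limn_esup_Lnorm2_lty (S : nat -> {poly R}) (M : R) N :
    (forall n, L (S (N + n)%N * S (N + n)%N) <= M) ->
  (limn_esup (fun n => Lnorm mu 2%:E (fun x => ((S n).[x])%:E)) < +oo)%E.
Proof.
move=> SM; apply: (@le_lt_trans _ _ (M `^ 2^-1)%:E); last exact: ltry.
rewrite /limn_esup limf_esupE.
apply: (@le_trans _ _ (ereal_sup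
   ((fun n => Lnorm mu 2%:E (fun x => ((S n).[x])%:E)) @` [set n | (N <= n)%N]))).
  by apply: ereal_inf_lbound; exists [set n | (N <= n)%N] => //; exists N.
apply: ge_ereal_sup => _ [n /= Nn <-].
rewrite Lnorm2_horner lee_fin; apply: ge0_ler_powR.
- by rewrite invr_ge0.
- rewrite nnegrE; apply: Rintegral_ge0 => x _.
  by rewrite hornerM -expr2 sqr_ge0.
- have := SM 0%N; rewrite nnegrE; apply: le_trans; apply: Rintegral_ge0 => x _.
  by rewrite hornerM -expr2 sqr_ge0.
- by rewrite -(subnKC Nn).
Qed.

Lemma integrable_norm_horner p :
  mu.-integrable setT (fun x : R => `|p.[x]|%:E).
Proof. exact: integrable_abse (integrable_horner mu_moments p). Qed.

Lemma integral_norm_horner_le p :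
  L (p * p) <= 1 -> (\int[mu]_x `|p.[x]|%:E <= 1)%E.
Proof.
(* |p| <= (1 + p^2) / 2 *)
move=> p1; pose g : {poly R} := (2^-1)%:P * (1 + p * p).
have gE : (\int[mu]_x (g.[x])%:E <= 1)%E.
  rewrite (mean_polyE mu_moments) lee_fin /g mul_polyC linearZ linearD /=.
  by rewrite mean_poly1; lra.
apply: le_trans gE; apply: ge0_le_integral => //.
- exact: (measurable_int mu (integrable_norm_horner p)).
- exact: (measurable_int mu (integrable_horner mu_moments g)).
- move=> x _; rewrite lee_fin /g !hornerE.
  have := sqr_ge0 (`|p.[x]| - 1); rewrite sqrrB real_normK ?num_real // => h.
  by rewrite -expr2; lra.
Qed.

(** The formula x^-1 = x * (x^2)^-1 also holds at 0, and reduces the inverse to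
a real power. *)
Lemma measurable_inv : measurable_fun [set: R] (fun x : R => x^-1).
Proof.
rewrite (_ : (fun _ => _) = (fun x => x * (x ^+ 2) `^ (-1))); last first.
  apply/funext => x; rewrite powR_inv1 ?sqr_ge0 //.
  have [->|x0] := eqVneq x 0; first by rewrite invr0 mul0r.
  by rewrite expr2 invfM mulrA divff // mul1r.
apply: measurable_funM => //.
by apply: (@measurableT_comp _ _ _ _ _ _ (@powR R ^~ (-1))).
Qed.

Variables (Q : nat -> {poly R}) (z : R) (F : R -> R).
Hypothesis Q0 : Q 0%N = 1.
Hypothesis Q_mean0 : forall n, L (Q n.+1) = 0.
Hypothesis Q_le1 : forall n, L (Q n * Q n) <= 1.
Hypothesis z_le : `|z| <= 2^-1.
Hypothesis mF : measurable_fun [set: measurableTypeR R] (fun x => (F x)%:E).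
Hypothesis FE : forall x, cvgn (pseries (fun n => (Q n).[x]) z) ->
  pseries (fun n => (Q n).[x]) z @ \oo --> F x.

Let a n (x : R) : \bar R := ((`|z| ^+ n)%:E * `|(Q n).[x]|%:E)%E.
Let g (x : R) : \bar R := (\sum_(0 <= n <oo) a n x)%E.

Let a_ge0 n x : (0 <= a n x)%E.
Proof. by rewrite mule_ge0 ?lee_fin. Qed.

Let a_int n : mu.-integrable setT (a n).
Proof. by apply: integrableZl => //; exact: integrable_norm_horner. Qed.

Let g_int : mu.-integrable setT g.
Proof.
have mg : measurable_fun [set: measurableTypeR R] g.
  apply: (eq_measurable_fun (fun x => (\sum_(0 <= n <oo | n \in xpredT) a n x)%E)).
    by move=> x _; apply: eq_eseriesl.
  apply: ge0_emeasurable_sum => [n x _ _|n _]; first exact: a_ge0.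
  exact: (measurable_int mu (a_int n)).
apply/integrableP; split => //.
under eq_integral => x _ do rewrite gee0_abs ?nneseries_ge0 //.
rewrite integral_nneseries //; last first.
  by move=> n; exact: (measurable_int mu (a_int n)).
(* comparison with the sum of 2 / 2 ^ (n + 1), which is 2 *)
apply: (@le_lt_trans _ _ (2%:E)); last exact: ltry.
apply: le_trans (@epsilon_trick0 R 2 xpredT _) => //.
apply: lee_nneseries => [n _ _|n _].
  by apply: integral_ge0 => x _; exact: a_ge0.
rewrite /a ge0_integralZl //; last 1 first.
- exact: (measurable_int mu (integrable_norm_horner (Q n))).
apply: (@le_trans _ _ ((`|z| ^+ n)%:E * 1)%E).
  by apply: lee_wpmul2l; rewrite ?lee_fin //; exact: integral_norm_horner_le.
rewrite mule1 lee_fin expnS natrM invfM mulrA divff // mul1r natrX -exprVn.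
by rewrite lerXn2r ?nnegrE ?invr_ge0.
Qed.

Let pseries_le_g x n : (`|(pseries (fun n => (Q n).[x]) z n)%:E| <= g x)%E.
Proof.
apply: (@le_trans _ _ (\sum_(0 <= k < n) a k x)%E); last first.
  exact: nneseries_lim_ge.
rewrite /pseries /series /= (_ : (\sum_(0 <= k < n) a k x)%E =
  (\sum_(0 <= k < n) `|z| ^+ k * `|(Q k).[x]|)%:E); last by rewrite -sumEFin.
rewrite lee_fin (le_trans (ler_norm_sum _ _ _)) //; apply: ler_sum => k _.
by rewrite normrM normrX mulrC.
Qed.

Let pseries_cvg x : g x \is a fin_num -> cvgn (pseries (fun n => (Q n).[x]) z).
Proof.
move=> gx; apply: normed_cvg; rewrite /normed_series_of /=.
apply: nondecreasing_is_cvgn.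
  by apply: nondecreasing_series => k _ _; exact: normr_ge0.
exists (fine (g x)) => _ [n _ <-]; rewrite -lee_fin fineK //.
apply: le_trans (@nneseries_lim_ge _ (a^~ x) xpredT 0 n _) => [|k _ _]; last first.
  exact: a_ge0.
rewrite /series /= -sumEFin; apply: lee_sum => k _.
by rewrite normrM normrX mulrC.
Qed.

(** The series of the functions |Q_n| |z|^n is integrable, because the L^1 norms
of the Q_n are at most 1; hence it converges almost everywhere and dominates
the partial sums, whose expectations are all equal to that of Q_0. *)
Lemma integral_generating_series :
  mu.-integrable setT (fun x => (F x)%:E) /\ (\int[mu]_x (F x)%:E)%E = 1%E.
Proof.
have pE n x : pseries (fun n => (Q n).[x]) z n =
    (\sum_(0 <= k < n) z ^+ k *: Q k).[x].
  rewrite horner_sum; apply: eq_bigr => k _.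
  by rewrite hornerZ mulrC.
have mp n : measurable_fun [set: measurableTypeR R]
    (fun x => (pseries (fun n => (Q n).[x]) z n)%:E).
  under eq_fun do rewrite pE.
  exact: (measurable_int mu (integrable_horner mu_moments _)).
have [||F_int _] := dominated_convergence measurableT mp mF _ g_int _.
- apply: filterS (integrable_ae measurableT g_int) => x /(_ I) gx _.
  by apply: cvg_EFin; [exact: nearW|exact: FE (pseries_cvg gx)].
- by apply: aeW => x n _; exact: pseries_le_g.
move=> Fcvg; split=> //; apply: (cvg_unique _ Fcvg) => //.
apply: cvg_near_cst; exists 1%N => // n /= n0.
under eq_integral do rewrite pE.
rewrite mean_polyE linear_sum big_ltn //= expr0 scale1r Q0 mean_poly1.
rewrite big_nat big1 ?addr0 // => -[|k] //= _.
by rewrite linearZ /= Q_mean0 mulr0.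
Qed.
End MeasureSide.

(** * A free Meixner measure is renormalizable *)

Lemma quadratic_gt0 (R : realFieldType) (p q z : R) :
  `|p| <= 2^-1 -> `|q| <= 2^-1 -> `|z| <= 2^-1 -> 0 < 1 + p * z + q * z ^+ 2.
Proof.
move=> p2 q2 z2.
have pz : `|p * z| <= 2^-1 * 2^-1 by rewrite normrM ler_pM.
have qz : `|q * z ^+ 2| <= 2^-1 * (2^-1 * 2^-1) by rewrite !normrM !ler_pM.
by move: pz qz; rewrite !ler_norml => /andP[? _] /andP[? _]; lra.
Qed.

Section MeixnerImpliesRenormalization.
Local Open Scope classical_set_scope.
Local Open Scope ring_scope.
Variables (R : realType) (mu : probability (measurableTypeR R) R).
Hypothesis mu_moments : finite_moments mu.

Let evalE :=
  (@hornerD R, @hornerN R, @hornerZ R, @hornerM R, @hornerX R, @hornerC R).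

Section Witness.
Variables (lam A B : R) (Q : nat -> {poly R}).
Let C := B + lam ^+ 2.
Let L : {scalar {poly R}} := mean_poly mu_moments.

Hypothesis lam_gt0 : 0 < lam.
Hypothesis lam_le : `|lam| <= 4^-1.
Hypothesis A_le : `|A| <= 4^-1.
Hypothesis B_le : `|B| <= 4^-1.
Hypothesis LXX : L ('X * 'X) = 1.
Hypothesis Q0 : Q 0%N = 1.
Hypothesis Q1 : Q 1%N = lam *: 'X.
Hypothesis Q2 : Q 2%N = (lam *: 'X - A%:P) * Q 1%N + B%:P - C%:P.
Hypothesis QS :
  forall n, Q n.+3 = (lam *: 'X - A%:P) * Q n.+2 - C *: Q n.+1.
Hypothesis Q_le1 : forall n, L (Q n * Q n) <= 1.
Hypothesis Q_orth : forall m n : nat, m != n -> L (Q m * Q n) = 0.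

Let E z := 1 + A * z + C * z ^+ 2.
Let N z := 1 + A * z + B * z ^+ 2.
Let D z x := 1 - (lam * x - A) * z + C * z ^+ 2.
Let rho z := lam * z / E z.
Let phi z x := (1 - rho z * x)^-1.

Let E_gt0 z : `|z| <= 2^-1 -> 0 < E z.
Proof.
move=> z2; apply: quadratic_gt0 => //; first by apply: le_trans A_le _; lra.
rewrite /C (le_trans (ler_normD _ _)) // normrX expr2.
have : `|lam| * `|lam| <= 4^-1 * 4^-1 by rewrite ler_pM.
by move=> /(lerD B_le) /le_trans; apply; lra.
Qed.

Let N_gt0 z : `|z| <= 2^-1 -> 0 < N z.
Proof.
move=> z2; apply: quadratic_gt0 => //.
  by apply: le_trans A_le _; lra.
by apply: le_trans B_le _; lra.
Qed.

Let near_half : \forall z \near (0 : R), `|z| <= 2^-1.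
Proof. by exists 2^-1 => [|z /=]; rewrite /= ?invr_gt0 // sub0r normrN => /ltW. Qed.

Let phiE z x : `|z| <= 2^-1 -> phi z x = E z / D z x.
Proof.
move=> z2; have E0 : E z != 0 by rewrite gt_eqF ?E_gt0.
rewrite /phi -[RHS]invrK invf_div; congr _^-1.
apply: (mulIf E0); rewrite divfK // mulrBl mul1r /rho.
by rewrite -[_ * x * _]mulrA [x * _]mulrC mulrA divfK // /E /D; ring.
Qed.

Let rhoE : expands_at0 rho
  (fun n => if n is m.+1 then lam * (cheb lam A B m).[0] else 0).
Proof.
apply: (@quadratic_expands_at0 _ _ (- A) C) => [n|].
  by rewrite chebSS !evalE /= -/C; ring.
near=> z; rewrite /rho /E /= !evalE; congr (_ / _); ring.
Unshelve. all: by end_near. Qed.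

Let phi_expansion : poly_expansion phi (renorm_coef lam A B).
Proof.
move=> x; apply: (@quadratic_expands_at0 _ _ (lam * x - A) C) => [n|].
  by rewrite renorm_coefSSS !evalE.
near=> z; rewrite phiE; last by near: z; exact: near_half.
by rewrite /E /D /= !evalE /=; congr (_ / _); ring.
Unshelve. all: by end_near. Qed.

Let QT := meixner_cheb Q1 Q2 QS.

(** For almost every x the series of the Q_n(x) z^n converges, to N / D since it
satisfies the recurrence; in particular D is nonzero there, as N is. *)
Let mean_phi z : `|z| <= 2^-1 -> ('E_mu[phi z] = (E z / N z)%:E)%E.
Proof.
move=> z2; have N0 : N z != 0 by rewrite gt_eqF ?N_gt0.
pose F x := N z / D z x.
have [|||F_int F1] := @integral_generating_series _ _ mu_moments Q z F Q0 _ Q_le1 z2.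
- by move=> n; rewrite -[Q n.+1]mulr1 -Q0; exact: Q_orth.
- pose p : {poly R} := (E z)%:P - (lam * z) *: 'X.
  apply/measurable_EFinP; apply: measurable_funM => //.
  have -> : (fun x => (D z x)^-1) = (fun y : R => y^-1) \o horner p.
    apply/funext => x; rewrite /= /p !evalE /= /D /E.
    by congr _^-1; ring.
  by apply: measurableT_comp; [exact: measurable_inv|exact: measurable_poly].
- move=> x cx.
  have := @pseries_quadratic_lim _ _ (lam * x - A) C _ z _ cx.
  rewrite -/(D z x) Q2 Q1 Q0 !evalE /= => DN.
  have {}DN : D z x * lim (pseries (fun n => (Q n).[x]) z @ \oo) = N z.
    by rewrite DN; [rewrite /N /C; ring|move=> n; rewrite QS !evalE].
  have D0 : D z x != 0 by apply: contraNneq N0 => D0; rewrite -DN D0 mul0r.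
  by rewrite /F -DN [X in X / _]mulrC mulfK.
rewrite unlock (_ : (fun x => _) = (fun x => (E z / N z)%:E * (F x)%:E)%E).
  by rewrite integralZl // F1 mule1.
apply/funext => x; rewrite phiE // -EFinM; congr EFin.
by rewrite /F mulrA divfK.
Qed.

Lemma mrm_applies_witness : mrm_applies mu (fun x => (1 - x)^-1).
Proof.
exists rho; split.
- by eexists; exact: rhoE.
- by rewrite /rho mulr0 mul0r.
- by rewrite (expands_at0_derive1 rhoE) /= hornerC mulr1 gt_eqF.
- exists (renorm_coef lam A B); split => //.
  + by move=> n; rewrite size_renorm_coef // gt_eqF.
  + apply: (@limn_esup_Lnorm2_lty _ _ mu_moments _ 4 3) => n.
    apply: (@renorm_coef_second_moment_le _ L _ lam A B Q) => //.
    * by move=> p; apply: Rintegral_ge0 => x _; rewrite hornerM -expr2 sqr_ge0.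
    * exact: (mean_poly1 mu_moments).
    * exact: (renorm_coef_meixner Q1 Q2 QS).
- exists Q; split; last by apply/(orthogonal_polysP mu_moments); exact: Q_orth.
  move=> x; apply: (@quadratic_expands_at0 _ _ (lam * x - A) C) => [n|].
    by rewrite QS !evalE.
  near=> z; have z2 : `|z| <= 2^-1 by near: z; exact: near_half.
  rewrite /mult_renorm -/(phi z) -/(phi z x) mean_phi // phiE //=.
  have E0 : E z != 0 by rewrite gt_eqF ?E_gt0.
  rewrite invf_div mulf_div [E z * N z]mulrC -mulf_div divff // mulr1.
  congr (_ / _); rewrite Q2 Q1 Q0 /N /C.
  by rewrite !evalE; ring.
Unshelve. all: by end_near. Qed.
End Witness.

(** The choice of lam makes lam, A and B at most 1/4 in absolute value, and
lam^2 omega_n at most 1, which bounds the norms of lam^n P_n. *)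
Lemma free_meixner_mrm_applies :
  standard mu -> free_meixner mu -> mrm_applies mu (fun x => (1 - x)^-1).
Proof.
move=> mu_std [a [b [_ [alpha [omega [[P [P_ms P_orth _ _ P_rec]]]]]]]].
move=> alpha0 omega1 alpha_a omega_b.
pose L : {scalar {poly R}} := mean_poly mu_moments.
have L1 : L 1 = 1 := mean_poly1 mu_moments.
have {}P_orth : forall m n : nat, m != n -> L (P m * P n) = 0.
  exact/(orthogonal_polysP mu_moments).
have [_ LXX] : L 'X = 0 /\ L ('X * 'X) = 1 := mean_poly_standard mu_moments mu_std.
pose K := 1 + `|a| + `|b|; pose lam := (4 * K)^-1.
have a0 := normr_ge0 a; have b0 := normr_ge0 b.
have K1 : 1 <= K by rewrite /K; lra.
have lam_gt0 : 0 < lam by rewrite invr_gt0; lra.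
have lamK : lam * K = 4^-1.
  by rewrite /lam invfM -mulrA mulVf ?mulr1 // gt_eqF // (lt_le_trans _ K1).
have lam_le : lam <= 4^-1 by nra.
have normlam : `|lam| = lam by rewrite gtr0_norm.
pose A := a * lam; pose B := b * lam ^+ 2.
have A_le : `|A| <= 4^-1.
  by rewrite normrM normlam -lamK mulrC ler_pM2l // /K; lra.
have bl_le : `|b| * lam <= 4^-1 by rewrite -lamK mulrC ler_pM2l // /K; lra.
have B_le : `|B| <= 4^-1 * 4^-1.
  by rewrite normrM normrX normlam expr2 mulrA ler_pM // ?mulr_ge0 // ltW.
have P0 : P 0%N = 1.
  have [/monicP lead1 size1] := P_ms 0%N.
  by rewrite [LHS]size1_polyC ?size1 //; move: lead1; rewrite lead_coefE size1 => ->.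
have P1 : P 1%N = 'X.
  by have := P_rec 0%N; rewrite alpha0 scale0r scaler0 !addr0 P0 mulr1.
pose Q n := lam ^+ n *: P n.
have Q_orth m n : m != n -> L (Q m * Q n) = 0.
  by move=> mn; rewrite -scalerAl -scalerAr !linearZ /= P_orth // !mulr0.
have omega_le n : (0 < n)%N -> lam ^+ 2 * omega n <= 1.
  have lam2 : lam ^+ 2 <= 4^-1 * 4^-1 by rewrite expr2 ler_pM // ltW.
  case: n => [|[|n]] // _; first by rewrite omega1 mulr1; lra.
  rewrite omega_b // mulrDr mulr1 mulrC -/B.
  have := ler_norm B; lra.
apply: (@mrm_applies_witness lam A B Q) => //; rewrite ?normlam //.
- by apply: le_trans B_le _; lra.
- by rewrite /Q expr0 scale1r.
- by rewrite /Q expr1 P1.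
- have := P_rec 1%N; rewrite alpha_a // omega1 P1 P0 => /(canLR (addrK _)).
  move=> /(canLR (addrK _)) P2; rewrite /Q -P2 P1 /A /B -!mul_polyC.
  by rewrite !(polyCD, polyCM, expr2); ring.
- move=> n; have := P_rec n.+2; rewrite alpha_a // omega_b // => /(canLR (addrK _)).
  move=> /(canLR (addrK _)) P3; rewrite /Q -P3 /A /B -!mul_polyC !exprS.
  by rewrite !(polyCD, polyCM, expr2); ring.
- elim=> [|n IHn].
    by rewrite /Q expr0 scale1r P0 mulr1 -/L L1.
  have QnS : L (Q n.+1 * Q n.+1) = lam ^+ 2 * omega n.+1 * L (Q n * Q n).
    rewrite /Q !second_moment_scale (second_moment_jacobi P_orth P_rec).
    by rewrite [lam ^+ n.+1]exprS; ring.
  have Qn0 : 0 <= L (Q n * Q n).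
    by apply: Rintegral_ge0 => x _; rewrite hornerM -expr2 sqr_ge0.
  by rewrite -/L QnS (le_trans (ler_piMl Qn0 (omega_le _ _))).
Qed.
End MeixnerImpliesRenormalization.

Theorem theorem2p3 (R : realType) (mu : probability (measurableTypeR R) R)
    (hmoments : finite_moments mu) (hsupport : infinite_set (msupport mu))
    (hstandard : standard mu) :
  mrm_applies mu (fun x : R => (1 - x)^-1) <-> free_meixner mu.
Proof.
split; first exact: mrm_applies_free_meixner.
exact: free_meixner_mrm_applies.
Qed.
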